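(* Let $n,m\ge 1$, $K_{\mathrm{tot}}\ge 2$ and $1\le K\le K_{\mathrm{tot}}$ be integers, and let scores $X_{ij\ell}=\mu_\theta+\alpha_i+\beta_{ij}+\gamma_\ell+\varepsilon_{ij\ell}$ follow the crossed judge model described in the context, in which a random set $S_J$ of $K$ judges scores every scenario--generation cell. Let $$\bar X=\frac{1}{nmK}\sum_{i=1}^{n}\sum_{j=1}^{m}\sum_{\ell\in S_J}X_{ij\ell}$$ be the benchmark score. Then $$\operatorname{Var}(\bar X)=\frac{\sigma_\alpha^2}{n}+\frac{\sigma_\beta^2}{nm}+\frac{\sigma_\varepsilon^2}{nmK}+\frac{\sigma_\gamma^2}{K}\cdot\frac{K_{\mathrm{tot}}-K}{K_{\mathrm{tot}}-1}.$$
   Context: Crossed judge model. A model $\theta$ is evaluated on $n$ scenarios, indexed by $i\in\{1,\dots,n\}$ and drawn by simple random sampling without replacement from a dataset, with $m$ generations per scenario, indexed by $j\in\{1,\dots,m\}$. Judges are indexed by $\ell\in\{1,\dots,K_{\mathrm{tot}}\}$ (the judge pool). The score given by judge $\ell$ to generation $j$ of scenario $i$ is $$X_{ij\ell}=\mu_\theta+\alpha_i+\beta_{ij}+\gamma_\ell+\varepsilon_{ij\ell},$$ where: - $\mu_\theta\in\mathbb R$ is a constant. - The scenario effects $\alpha_i$ are i.i.d. real random variables with mean $0$ and finite variance $\sigma_\alpha^2$. - The generation effects $\beta_{ij}$ are i.i.d. with mean $0$ and finite variance $\sigma_\beta^2$. - The residuals $\varepsilon_{ij\ell}$ are i.i.d.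 (over all $i,j$ and all $\ell$ in the pool) with mean $0$ and finite variance $\sigma_\varepsilon^2$. - The families $\alpha$, $\beta$, $\varepsilon$ are mutually independent. No distributional assumptions beyond finite second moments are made. - The judge offsets $\gamma_1,\dots,\gamma_{K_{\mathrm{tot}}}\in\mathbb R$ are fixed (non-random) constants with $\sum_{\ell=1}^{K_{\mathrm{tot}}}\gamma_\ell=0$, and $\sigma_\gamma^2=K_{\mathrm{tot}}^{-1}\sum_{\ell=1}^{K_{\mathrm{tot}}}\gamma_\ell^2$. - The set of selected judges $S_J\subseteq\{1,\dots,K_{\mathrm{tot}}\}$ is a simple random sample without replacement of size $K$ (uniform over all $K$-element subsets). The scenario sample and $S_J$ are independent of each other and of all the random effects $\alpha,\beta,\varepsilon$. The same set $S_J$ is used for every pair $(i,j)$. *)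

(* Defs.v *)
From HB Require Import structures.
From mathcomp Require Import all_boot all_order all_algebra.
From mathcomp Require Import all_classical all_reals all_analysis.

Set Implicit Arguments.
Unset Strict Implicit.
Unset Printing Implicit Defensive.

Import Order.TTheory GRing.Theory Num.Theory.
Import numFieldNormedType.Exports.

Local Open Scope classical_set_scope.
Local Open Scope ring_scope.

Section Independence.
Context {d : measure_display} {T : measurableType d} {R : realType}.
Variable P : probability T R.

Definition mutually_independent (I : finType) (F : I -> set (set T)) : Prop :=
  forall (J : {set I}) (E : I -> set T),
    (forall i, i \in J -> F i (E i)) ->
    P (\bigcap_(i in [set` J]) E i) = (\prod_(i in J) P (E i))%E.

Definition sigma_RV (X : {RV P >-> R}) : set (set T) :=
  g_sigma_algebra_preimage X.

Definition sigma_family (I : finType) (X : I -> {RV P >-> R}) : set (set T) :=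
  <<s \bigcup_i sigma_RV (X i) >>.

(* {set U} carries its discrete sigma-algebra. *)
Definition sigma_sample (U : finType) (S : T -> {set U}) : set (set T) :=
  preimage_set_system setT S setT.

Definition iid (I : finType) (X : I -> {RV P >-> R}) : Prop :=
  mutually_independent (fun i => sigma_RV (X i)) /\
  forall i j (A : set R), measurable A ->
    distribution P (X i) A = distribution P (X j) A.

(* Membership in Lfun P 2 ensures that the (total) expectation and variance
   below are genuine Lebesgue integrals of integrable functions. *)
Definition centered_with_variance (I : finType) (X : I -> {RV P >-> R})
    (v : R) : Prop :=
  forall i, [/\ (X i : T -> R) \in Lfun P 2%:E,
    ('E_P[X i] = 0)%E & ('V_P[X i] = v%:E)%E].

(* The uniform law on the k-element subsets of U; values of S of another
   cardinality only occur with probability 0. *)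
Definition simple_random_sample (U : finType) (k : nat) (S : T -> {set U})
    : Prop :=
  forall A : {set U}, measurable (S @^-1` [set A]) /\
    P (S @^-1` [set A]) =
      (if #|A| == k then ('C(#|U|, k)%:R : R)^-1 else 0)%:E.

End Independence.

Section CrossedJudgeModel.
Context {T : Type} {R : realType} {n m Ktot : nat}.
Variables (mu : R) (alpha : 'I_n -> T -> R) (beta : 'I_n * 'I_m -> T -> R)
  (gamma : 'I_Ktot -> R) (eps : 'I_n * 'I_m * 'I_Ktot -> T -> R).

Definition score (i : 'I_n) (j : 'I_m) (l : 'I_Ktot) (w : T) : R :=
  mu + alpha i w + beta (i, j) w + gamma l + eps (i, j, l) w.

Definition benchmark_score (K : nat) (SJ : T -> {set 'I_Ktot}) (w : T) : R :=
  (n * m * K)%N%:R^-1 *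
  \sum_(i < n) \sum_(j < m) \sum_(l in SJ w) score i j l w.

End CrossedJudgeModel.

Definition judge_variance {R : realType} (Ktot : nat) (gamma : 'I_Ktot -> R)
    : R :=
  Ktot%:R^-1 * \sum_(l < Ktot) gamma l ^+ 2.

(* Main.v *)
(** Conditionally on the selected judges [S_J = A], the benchmark score is a
    constant depending on [A] plus a linear combination of the pairwise
    uncorrelated, centered effects [alpha], [beta] and [eps], so its conditional
    variance is the sum of the squared weights times the variances; for
    [#|A| = K] it does not depend on [A]. By the law of total variance it
    remains to add the variance of the conditional mean
    [mu + K^-1 * \sum_(l in A) gamma l] over a uniform [K]-subset [A], which is
    a finite counting problem. *)

Require Import Defs.
From HB Require Import structures.
From mathcomp Require Import all_boot all_order all_algebra.
From mathcomp Require Import all_classical all_reals all_analysis.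
From mathcomp Require Import measurable_realfun.
From mathcomp Require Import ring.

Set Implicit Arguments.
Unset Strict Implicit.
Unset Printing Implicit Defensive.

Import Order.TTheory GRing.Theory Num.Theory.
Import numFieldNormedType.Exports.

Local Open Scope classical_set_scope.
Local Open Scope ring_scope.

(** * Sums over the subsets of fixed size of a finite set *)

Lemma sum_draws_const (R : pzSemiRingType) (U : finType) (k : nat) (x : R) :
  \sum_(A : {set U} | #|A| == k) x = 'C(#|U|, k)%:R * x.
Proof.
rewrite mulr_natl -card_draws -sumr_const.
by apply: eq_bigl => A; rewrite inE.
Qed.

Section FiniteSubsets.
Variables (R : realType) (U : finType) (gamma : U -> R).
Hypothesis gamma0 : \sum_x gamma x = 0.

(** These sets are the [k]-subsets of the complement of [[set x; y]]. The size [(x != y).+1] of that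
    pair treats the diagonal and off-diagonal cases at once. *)
Lemma card_draws_notin2 (k : nat) (x y : U) :
  #|[set A : {set U} | (#|A| == k) && ((x \notin A) && (y \notin A))]%SET| =
  'C(#|U| - (x != y).+1, k).
Proof.
transitivity #|[set A : {set U} | A \subset ~: [set x; y]%SET & #|A| == k]%SET|.
  apply: eq_card => A; rewrite !inE -finset.disjoints_subset disjoint_sym.
  by rewrite finset.disjoints_subset finset.subUset !finset.sub1set !inE andbC.
by rewrite cards_draws cardsCs finset.setCK cards2.
Qed.

Let sum_in (A : {set U}) :
  \sum_(x in A) gamma x = - \sum_x gamma x * (x \notin A)%:R.
Proof.
have -> : \sum_x gamma x * (x \notin A)%:R = \sum_(x | x \notin A) gamma x.
  rewrite [RHS]big_mkcond; apply: eq_bigr => x _.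
  by case: (x \in A); rewrite ?mulr1 ?mulr0.
apply/eqP; rewrite -addr_eq0; apply/eqP; rewrite -[RHS]gamma0.
by rewrite [RHS](bigID (mem A)).
Qed.

Let sum_notin2 (k : nat) (x y : U) :
  \sum_(A : {set U} | #|A| == k) ((x \notin A)%:R * (y \notin A)%:R) =
  'C(#|U| - (x != y).+1, k)%:R :> R.
Proof.
rewrite -card_draws_notin2 -sum1_card natr_sum big_mkcond [RHS]big_mkcond.
apply: eq_bigr => A _; rewrite !inE -natrM mulnb.
by case: (#|A| == k) => //=; case: (_ && _).
Qed.

(** By symmetry each point is avoided by equally many [k]-subsets, so the total is a multiple of the
    sum of [gamma]. *)
Lemma sum_draws (k : nat) :
  \sum_(A : {set U} | #|A| == k) \sum_(x in A) gamma x = 0.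
Proof.
under eq_bigr do rewrite sum_in.
rewrite sumrN exchange_big /=; apply/eqP; rewrite oppr_eq0; apply/eqP.
transitivity (\sum_x gamma x * 'C(#|U| - 1, k)%:R); last first.
  by rewrite -mulr_suml gamma0 mul0r.
apply: eq_bigr => x _; rewrite -mulr_sumr; congr (_ * _).
transitivity ('C(#|U| - (x != x).+1, k)%:R : R); last by rewrite eqxx.
rewrite -sum_notin2; apply: eq_bigr => A _.
by case: (x \notin A); rewrite ?mulr1 ?mulr0.
Qed.

(* As [gamma] sums to 0, the sum over [A] is minus the sum over its complement,
   and the sets avoiding one or two given points are counted by binomials. *)
Lemma sum_draws_sqr (k : nat) : (1 < #|U|)%N ->
  \sum_(A : {set U} | #|A| == k.+1) (\sum_(x in A) gamma x) ^+ 2 =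
  'C(#|U| - 2, k)%:R * \sum_x gamma x ^+ 2.
Proof.
move=> U1.
transitivity (\sum_x \sum_y gamma x * gamma y *
    ('C(#|U| - (x != y).+1, k.+1))%:R).
  under eq_bigr => A _.
    rewrite sum_in sqrrN expr2 big_distrlr /=.
    over.
  rewrite exchange_big; apply: eq_bigr => x _.
  rewrite exchange_big; apply: eq_bigr => y _ /=.
  rewrite -sum_notin2 mulr_sumr; apply: eq_bigr => A _.
  by rewrite mulrACA.
have U2 : (#|U| - 1 = (#|U| - 2).+1)%N by rewrite -subSn.
(* Pascal's rule: a diagonal pair is counted ['C(#|U| - 2, k)] times more often than an off-diagonal
   one. The common count multiplies the square of the sum of [gamma], which is 0; only the diagonal
   excess survives. *)
transitivity (\sum_x \sum_y gamma x * gamma y * 'C(#|U| - 2, k.+1)%:R +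
    \sum_x \sum_y gamma x * gamma y * ((x == y)%:R * 'C(#|U| - 2, k)%:R)).
  rewrite -big_split; apply: eq_bigr => x _ /=.
  rewrite -big_split; apply: eq_bigr => y _ /=.
  rewrite -mulrDr; case: eqVneq => _ /=; rewrite ?mul0r ?addr0// U2 binS mul1r.
  by rewrite natrD.
rewrite [X in X + _]big1 ?add0r; last first.
  by move=> x _; rewrite -mulr_suml -mulr_sumr gamma0 mulr0 mul0r.
rewrite mulr_sumr; apply: eq_bigr => x _.
rewrite (bigD1 x)//= eqxx mul1r big1 ?addr0 1?mulrC ?expr2// => y.
by rewrite eq_sym => /negPf ->; rewrite mul0r mulr0.
Qed.

End FiniteSubsets.

(** Two absorptions: the factor [k.+1] lowers both indices of the binomial, then the remaining
    factor lowers only the upper one. *)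
Lemma bin_mul_diag2 (N k : nat) :
  (k.+1 * (N.+2 - k.+1) * 'C(N.+2, k.+1) = N.+2 * N.+1 * 'C(N, k))%N.
Proof.
rewrite mulnAC -mul_bin_diag /= -!mulnA; congr (_ * _)%N.
by rewrite subSS mulnC -mul_bin_down mulnC.
Qed.

(** * Independence, and moments of linear combinations and of sampled variables *)

Section Independence.
Context {d : measure_display} {T : measurableType d} {R : realType}.
Variable P : probability T R.

Definition independent_rv (X Y : T -> R) : Prop :=
  forall A B : set R, measurable A -> measurable B ->
    P (X @^-1` A `&` Y @^-1` B) = (P (X @^-1` A) * P (Y @^-1` B))%E.

Lemma mutually_independent2 (I : finType) (F : I -> set (set T)) (i j : I)
    (A B : set T) :
  mutually_independent P F -> i != j -> F i A -> F j B ->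
  P (A `&` B) = (P A * P B)%E.
Proof.
move=> indF ij FA FB.
have := indF [set i; j]%SET (fun k => if k == i then A else B).
rewrite finset.big_setU1 ?inE //= finset.big_set1 eqxx eq_sym (negPf ij).
move=> <-; last first.
  by move=> k /finset.set2P[] ->; rewrite ?eqxx // eq_sym (negPf ij).
congr (P _); apply/seteqP; split => [w [Aw Bw] k /=|w /= H].
  by move=> /finset.set2P[] ->; rewrite ?eqxx // eq_sym (negPf ij).
split.
  by have := H i; rewrite /= eqxx; apply; rewrite !inE eqxx.
by have := H j; rewrite /= eq_sym (negPf ij); apply; rewrite !inE eqxx orbT.
Qed.

(** Independence says that the joint law agrees with the product law on rectangles, hence
    everywhere; Fubini then splits the integral of the product. *)
Lemma expectationM_indep (X Y : T -> R) :
  X \in Lfun P 1 -> Y \in Lfun P 1 -> X \* Y \in Lfun P 1 ->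
  independent_rv X Y -> ('E_P[X \* Y] = 'E_P[X] * 'E_P[Y])%E.
Proof.
move=> /Lfun1_integrable iX /Lfun1_integrable iY /Lfun1_integrable iXY indXY.
have mX : measurable_fun setT X by apply/measurable_EFinP/(measurable_int P).
have mY : measurable_fun setT Y by apply/measurable_EFinP/(measurable_int P).
pose X' : {mfun T >-> R} := mfun_Sub (mem_set mX).
pose Y' : {mfun T >-> R} := mfun_Sub (mem_set mY).
have mXY : measurable_fun setT (fun w => (X w, Y w)).
  exact: measurable_fun_pair.
pose XY : {mfun T >-> (R * R)%type} := mfun_Sub (mem_set mXY).
pose f (z : R * R) := (z.1 * z.2)%:E.
have mf : measurable_fun setT f.
  by apply/measurable_EFinP; apply: measurable_funM.
have jointE (Z : set (R * R)) : measurable Z ->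
    (distribution P X' \x distribution P Y')%E Z = distribution P XY Z.
  by move=> mZ; exact: product_measure_unique.
have if_ : (distribution P XY).-integrable setT f.
  exact: integrable_pushforward.
have if' : (distribution P X' \x distribution P Y')%E.-integrable setT f.
  apply/integrableP; split => //.
  rewrite (eq_measure_integral (distribution P XY)).
    by have /integrableP[] := if_.
  by move=> Z mZ _; exact: jointE.
rewrite unlock.
transitivity (\int[distribution P XY]_z f z)%E.
  by rewrite integral_distribution.
rewrite -(@eq_measure_integral _ _ _ _ _
  (distribution P X' \x distribution P Y')%E); last first.
  by move=> Z mZ _; exact: jointE.
rewrite -integral12_prod_meas1//.
transitivity (\int[distribution P X']_x (x%:E * (\int[P]_w (Y w)%:E)))%E.
  apply: eq_integral => x _; rewrite /fubini_F /f /=.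
  under eq_integral do rewrite EFinM.
  rewrite integralZl//; last exact: integrable_pushforward.
  by congr (_ * _)%E; rewrite integral_distribution.
(* The mean of [Y] is finite, so it can be pulled out as a real scalar. *)
rewrite -(fineK (integrable_fin_num measurableT iY)) /=.
rewrite (@integralZr _ _ _ _ _ measurableT EFin); last first.
  exact: integrable_pushforward.
by congr (_ * _)%E; rewrite integral_distribution.
Qed.

Lemma Lfun2_Lfun1 (X : T -> R) : X \in Lfun P 2%:E -> X \in Lfun P 1.
Proof. by apply: Lfun_subset12; rewrite fin_num_measure. Qed.

Lemma measurable_Lfun (p : \bar R) (X : T -> R) :
  X \in Lfun P p -> measurable_fun setT X.
Proof. by move=> /sub_Lfun_mfun; rewrite inE. Qed.

Lemma expectation_lincomb (J : finType) (c : J -> R) (Z : J -> T -> R) :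
  (forall j, Z j \in Lfun P 1) ->
  ('E_P[fun w => (\sum_j c j * Z j w)%R] = \sum_j (c j)%:E * 'E_P[Z j])%E.
Proof.
move=> Z1; rewrite unlock.
under eq_integral do rewrite -sumEFin.
rewrite integral_sum//; last first.
  move=> j; apply: (@eq_integrable _ _ _ _ _ measurableT
    (fun w => (c j)%:E * (Z j w)%:E)%E) => //.
  by apply: integrableZl => //; apply/Lfun1_integrable.
apply: eq_bigr => j _.
under eq_integral do rewrite EFinM.
by rewrite integralZl//; apply/Lfun1_integrable.
Qed.

Lemma Lfun2_lincomb (J : finType) (c : J -> R) (Z : J -> T -> R) :
  (forall j, Z j \in Lfun P 2%:E) ->
  (fun w => \sum_j c j * Z j w) \in Lfun P 2%:E.
Proof.
move=> Z2; rewrite (_ : (fun _ => _) = \sum_j c j \*: Z j); last first.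
  by apply/funext => w; rewrite fct_sumE.
by rewrite rpred_sum ?lee1n// => ? j _; rewrite rpredZ.
Qed.

(** Pairwise independence and centering make the [Z j] orthogonal, so only the diagonal of the
    expanded square contributes. *)
Lemma variance_lincomb (J : finType) (c v : J -> R) (Z : J -> T -> R) :
  (forall j, Z j \in Lfun P 2%:E) -> (forall j, 'E_P[Z j] = 0)%E ->
  (forall j, 'V_P[Z j] = (v j)%:E)%E ->
  (forall i j, i != j -> independent_rv (Z i) (Z j)) ->
  ('V_P[fun w => (\sum_j c j * Z j w)%R] = (\sum_j c j ^+ 2 * v j)%:E)%E.
Proof.
move=> Z2 Z0 Zv Zind; have Z1 j := Lfun2_Lfun1 (Z2 j).
have ZZ i j : ('E_P[Z i \* Z j] = (v i * (i == j)%:R)%:E)%E.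
  case: eqVneq => [<-|ij]; last first.
    rewrite expectationM_indep ?Lfun2_mul_Lfun1 ?Z0 ?mul0e ?mulr0//.
    exact: Zind.
  rewrite mulr1 -Zv varianceE// Z0 expe2 mul0e sube0.
  by congr expectation; apply/funext => w.
rewrite varianceE ?Lfun2_lincomb// expectation_lincomb//.
rewrite [X in (_ - X ^+ 2)%E]big1 ?expe2 ?mul0e ?sube0; last first.
  by move=> j _; rewrite Z0 mule0.
(* The square is itself a linear combination, indexed by pairs, so [expectation_lincomb] applies a
   second time. *)
rewrite (_ : _ ^+ 2 = fun w =>
    \sum_(p : J * J) (c p.1 * c p.2) * (Z p.1 \* Z p.2) w); last first.
  apply/funext => w; rewrite [LHS]expr2 big_distrlr /=.
  rewrite -(pair_big xpredT xpredT
    (fun i j => c i * c j * (Z i \* Z j) w)) /=.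
  apply: eq_bigr => i _; apply: eq_bigr => j _.
  by rewrite mulrACA.
rewrite expectation_lincomb; last by move=> p; apply: Lfun2_mul_Lfun1.
rewrite -sumEFin -(pair_big xpredT xpredT
  (fun i j => (c i * c j)%:E * 'E_P[Z i \* Z j])%E) /=.
apply: eq_bigr => i _; rewrite (bigD1 i)//= ZZ eqxx mulr1.
rewrite big1 ?adde0 -?EFinM ?expr2//.
by move=> j; rewrite eq_sym => /negPf ij; rewrite ZZ ij mulr0 mule0.
Qed.

(** Conditioning on a finite-valued variable: [Y (S w) w] is the sum over [A] of [Y A] times the
    indicator of the event that [S] equals [A], and independence factors each term. *)
Lemma expectation_sample (U : finType) (S : T -> {set U})
    (Y : {set U} -> T -> R) :
  (forall A, measurable (S @^-1` [set A])) ->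
  (forall A, Y A \in Lfun P 1) ->
  (forall A (D : set {set U}) B, measurable B ->
    P (S @^-1` D `&` Y A @^-1` B) = (P (S @^-1` D) * P (Y A @^-1` B))%E) ->
  (fun w => Y (S w) w) \in Lfun P 1 /\
  ('E_P[fun w => Y (S w) w] = \sum_A P (S @^-1` [set A]) * 'E_P[Y A])%E.
Proof.
move=> mS Y1 ind.
have YE : (fun w => Y (S w) w) = \sum_A \1_(S @^-1` [set A]) \* Y A.
  apply/funext => w; rewrite fct_sumE (bigD1 (S w))//= indicE mem_set//= mul1r.
  rewrite big1 ?addr0// => A AS; rewrite indicE memNset ?mul0r// => SA.
  by rewrite -SA eqxx in AS.
have YA1 A : \1_(S @^-1` [set A]) \* Y A \in Lfun P 1.
  apply/Lfun1_integrable.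
  apply: (@le_integrable _ _ _ _ _ measurableT _ (EFin \o Y A)).
  - apply/measurable_EFinP; apply: measurable_funM.
      exact: measurable_indic.
    exact: measurable_Lfun (Y1 A).
  - move=> w _ /=; rewrite lee_fin normrM ler_piMl// indicE.
    by case: (_ \in _); rewrite ?normr1 ?normr0.
  - exact/Lfun1_integrable.
split; first by rewrite YE rpred_sum.
rewrite YE -(big_map (fun A => \1_(S @^-1` [set A]) \* Y A) xpredT id).
rewrite expectation_sum; last by move=> _ /mapP[A _ ->].
rewrite big_map; apply: eq_bigr => A _.
rewrite expectationM_indep//; last 2 first.
- by apply/Lfun1_integrable; exact: integrable_indic.
(* An event about the indicator is an event about [S], with the preimage of [C] under [\1_[set A]]
   as its set of values [D]. *)
- move=> C B mC mB; rewrite -(ind A ((\1_[set A] : _ -> R) @^-1` C))//.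
by rewrite expectation_indic.
Qed.

End Independence.

(** * Total variance over a uniform sample, and events generated by families *)

Section IndependenceOfFamilies.
Context {d : measure_display} {T : measurableType d} {R : realType}.
Variable P : probability T R.

(** Law of total variance: [e A] and [s] are the conditional mean and variance given that [S] equals
    [A]. It follows from [expectation_sample] applied to [Y] and to its square. *)
Lemma variance_sample (U : finType) (k : nat) (S : T -> {set U})
    (Y : {set U} -> T -> R) (e : {set U} -> R) (s : R) :
  (k <= #|U|)%N -> simple_random_sample P k S ->
  (forall A, Y A \in Lfun P 2%:E) ->
  (forall A (D : set {set U}) B, measurable B ->
    P (S @^-1` D `&` Y A @^-1` B) = (P (S @^-1` D) * P (Y A @^-1` B))%E) ->
  (forall A : {set U}, #|A| = k ->
    'E_P[Y A] = (e A)%:E /\ 'V_P[Y A] = s%:E)%E ->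
  ('V_P[fun w => Y (S w) w] =
    (s + 'C(#|U|, k)%:R^-1 * (\sum_(A : {set U} | #|A| == k) e A ^+ 2) -
     ('C(#|U|, k)%:R^-1 * (\sum_(A : {set U} | #|A| == k) e A)) ^+ 2)%:E)%E.
Proof.
move=> kU srsS Y2 ind EV.
have Y1 A := Lfun2_Lfun1 (Y2 A).
have YY1 A : Y A \* Y A \in Lfun P 1 by exact: Lfun2_mul_Lfun1.
have mS A : measurable (S @^-1` [set A]) by have [] := srsS A.
have [f1 Ef] := expectation_sample mS Y1 ind.
have [|ff1 Eff] := expectation_sample mS YY1.
  move=> A D B mB; apply: (ind A D ((fun x => x * x) @^-1` B)).
  rewrite -[X in measurable X]setTI.
  by have : measurable_fun [set: R] (fun x : R => x * x);
    [exact: measurable_funM|exact].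
(* Sets of size other than [k] have probability 0, so [g] has to be known on [k]-subsets only. *)
have mean (g : {set U} -> \bar R) (h : {set U} -> R) :
    (forall A : {set U}, #|A| = k -> g A = (h A)%:E) ->
    (\sum_A P (S @^-1` [set A]) * g A)%E =
    ('C(#|U|, k)%:R^-1 * (\sum_(A : {set U} | #|A| == k) h A))%:E.
  move=> gh; rewrite mulr_sumr -sumEFin [RHS]big_mkcond; apply: eq_bigr => A _.
  have [_ ->] := srsS A.
  by case: eqP => [/gh ->|_]; rewrite ?EFinM ?mul0e.
rewrite /variance covarianceE// Ef (mean _ e); last by move=> A /EV[].
rewrite Eff (mean _ (fun A => s + e A ^+ 2)); last first.
  move=> A /EV[EA VA].
  rewrite EFinD -VA varianceE// EA EFin_expe subeK//.
rewrite -EFinM -EFinB expr2; congr (_ - _)%:E.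
rewrite big_split /= mulrDr; congr (_ + _).
rewrite sum_draws_const mulKf//.
by rewrite pnatr_eq0 -lt0n bin_gt0.
Qed.

Lemma sigma_RV_preimage (X : {RV P >-> R}) (B : set R) :
  measurable B -> sigma_RV X (X @^-1` B).
Proof. by move=> mB; exists B => //; rewrite setTI. Qed.

Lemma sigma_family_preimage (I : finType) (X : I -> {RV P >-> R}) i
    (B : set R) : measurable B -> sigma_family X (X i @^-1` B).
Proof.
move=> mB; apply: sub_sigma_algebra; exists i => //.
exact: sigma_RV_preimage.
Qed.

Lemma iid_independent_rv (I : finType) (X : I -> {RV P >-> R}) i j :
  iid X -> i != j -> independent_rv P (X i) (X j).
Proof.
move=> [indX _] ij A B mA mB.
by apply: (mutually_independent2 indX ij); exact: sigma_RV_preimage.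
Qed.

Lemma independent_rvC (X Y : T -> R) :
  independent_rv P X Y -> independent_rv P Y X.
Proof. by move=> XY A B mA mB; rewrite setIC XY// muleC. Qed.

(** With [<<s F>>] as the measurable structure on [T], this is measurability of an affine
    combination. It places the events of the conditional score in the sigma-algebra of the
    effects. *)
Lemma sigma_algebra_affine (F : set (set T)) (J : finType) (r : R)
    (c : J -> R) (Z : J -> T -> R) :
  (forall j (B : set R), measurable B -> <<s F >> (Z j @^-1` B)) ->
  forall B : set R, measurable B ->
    <<s F >> ((fun w => r + \sum_j c j * Z j w) @^-1` B).
Proof.
move=> FZ B mB; pose T' := g_sigma_algebraType F.
have mZ j : measurable_fun setT (Z j : T' -> R).
  by move=> _ C mC; rewrite setTI; exact: FZ.
have : measurable_fun setT ((fun w => r + \sum_j c j * Z j w) : T' -> R).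
  apply: measurable_funD => //; apply: measurable_sum => j.
  exact: measurable_funM.
by move=> /(_ measurableT _ mB); rewrite setTI.
Qed.

End IndependenceOfFamilies.

(** * Weights of the effects in the benchmark score, and closed forms *)

(** Separates the part fixed by the judges from the effects. The size [#|S w|] stays symbolic
    because it equals [K] only almost surely; membership indicators let the [eps] sum range over a
    fixed index set. *)
Lemma benchmark_scoreE (T : Type) (R : realType) (n m Ktot K : nat) (mu : R)
    (alpha : 'I_n -> T -> R) (beta : 'I_n * 'I_m -> T -> R)
    (gamma : 'I_Ktot -> R) (eps : 'I_n * 'I_m * 'I_Ktot -> T -> R)
    (S : T -> {set 'I_Ktot}) (w : T) :
  benchmark_score mu alpha beta gamma eps K S w =
  (n * m * K)%N%:R^-1 *
  ((n * m)%N%:R * (#|S w|%:R * mu + \sum_(l in S w) gamma l) +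
   (\sum_i m%:R * (#|S w|%:R * alpha i w) +
    (\sum_p #|S w|%:R * beta p w + \sum_q (q.2 \in S w)%:R * eps q w))).
Proof.
rewrite /benchmark_score; set A := S w; congr (_ * _); rewrite pair_big /=.
transitivity (\sum_(p : 'I_n * 'I_m)
    ((#|A|%:R * mu + \sum_(l in A) gamma l) + #|A|%:R * alpha p.1 w +
     #|A|%:R * beta p w + \sum_l (l \in A)%:R * eps (p, l) w)).
  apply: eq_bigr => -[i j] _.
  rewrite /score !big_split /= !sumr_const !mulr_natl.
  rewrite [X in _ + X = _]big_mkcond /=.
  rewrite [X in _ = _ + X](eq_bigr
    (fun l => if l \in A then eps (i, j, l) w else 0)).
    by congr (_ + _); ring.
  by move=> l _; case: (l \in A); rewrite ?mul1r ?mul0r.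
rewrite 3!big_split /= sumr_const card_prod !card_ord.
rewrite -[_ *+ (n * m)]mulr_natl -!addrA; congr (_ + (_ + (_ + _))).
- rewrite -(pair_big xpredT xpredT
    (fun i (j : 'I_m) => #|A|%:R * alpha i w)) /=.
  by apply: eq_bigr => i _; rewrite sumr_const card_ord -[LHS]mulr_natl.
- by rewrite pair_big /=; apply: eq_bigr => -[].
Qed.

(** Produces the finite-population correction from the binomial counts, by [bin_mul_diag2]. *)
Lemma bin_ratio (R : realType) (N k : nat) : (1 < N)%N -> (0 < k <= N)%N ->
  'C(N, k)%:R^-1 * (k%:R^-1 ^+ 2 * 'C(N - 2, k.-1)%:R) =
  N%:R^-1 * (k%:R^-1 * ((N - k)%N%:R / (N - 1)%N%:R)) :> R.
Proof.
case: N => [|[|N]]// _; case: k => // k /andP[_ kN].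
have nz (i : nat) : (0 < i)%N -> i%:R != 0 :> R by rewrite pnatr_eq0 -lt0n.
have C0 := nz _ (eq_ind_r is_true kN (bin_gt0 N.+2 k.+1)).
have k0 := nz _ (ltn0Sn k); have N1 := nz _ (ltn0Sn N).
have N2 := nz _ (ltn0Sn N.+1).
have := congr1 (fun i => i%:R : R) (bin_mul_diag2 N k).
rewrite !natrM !subn1 !subn2 /= => E.
move: C0 k0 N2 N1 E; rewrite subSS.
move: 'C(_, _)%:R 'C(_, _)%:R k.+1%:R N.+2%:R N.+1%:R (N.+1 - k)%:R.
move=> C C' a b b' e C'0 a0 b0 b'0 E.
have -> : C = a * e * C' / (b * b') by rewrite E; field; rewrite b0 b'0.
by field; rewrite C'0 a0 b0 b'0.
Qed.

(** Squared weights times multiplicities: [n] scenario effects, [n * m] generation effects, and [K]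
    selected residuals in each of the [n * m] cells. *)
Lemma weighted_variances (R : fieldType) (n m K : nat) (a b e : R) :
  n%:R != 0 :> R -> m%:R != 0 :> R -> K%:R != 0 :> R ->
  ((n * m * K)%N%:R^-1 * (m%:R * K%:R)) ^+ 2 * a *+ n +
  ((n * m * K)%N%:R^-1 * K%:R) ^+ 2 * b *+ (n * m) +
  (n * m * K)%N%:R^-1 ^+ 2 * K%:R * e *+ (n * m) =
  a / n%:R + b / (n * m)%N%:R + e / (n * m * K)%N%:R.
Proof.
move=> n0 m0 K0; rewrite -[_ * a *+ _]mulr_natl -[_ * b *+ _]mulr_natl.
rewrite -[_ * e *+ _]mulr_natl !natrM.
move: n%:R m%:R K%:R n0 m0 K0 => x y z x0 y0 z0.
by field; rewrite x0 y0 z0.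
Qed.

Theorem proposition1 (R : realType) (d : measure_display)
    (T : measurableType d) (P : probability T R)
    (n m Ktot K N : nat)
    (hn : (1 <= n)%N) (hm : (1 <= m)%N) (hKtot : (2 <= Ktot)%N)
    (hK : (1 <= K <= Ktot)%N) (hN : (n <= N)%N)
    (mu sigma_alpha sigma_beta sigma_eps : R)
    (alpha : 'I_n -> {RV P >-> R})
    (beta : 'I_n * 'I_m -> {RV P >-> R})
    (eps : 'I_n * 'I_m * 'I_Ktot -> {RV P >-> R})
    (gamma : 'I_Ktot -> R)
    (SD : T -> {set 'I_N}) (SJ : T -> {set 'I_Ktot})
    (alpha_iid : iid alpha)
    (alpha_moments : centered_with_variance alpha (sigma_alpha ^+ 2))
    (beta_iid : iid beta)
    (beta_moments : centered_with_variance beta (sigma_beta ^+ 2))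
    (eps_iid : iid eps)
    (eps_moments : centered_with_variance eps (sigma_eps ^+ 2))
    (effects_independent : mutually_independent P
      (tnth [tuple sigma_family alpha; sigma_family beta; sigma_family eps]))
    (gamma_sum0 : \sum_(l < Ktot) gamma l = 0)
    (scenario_sample : simple_random_sample P n SD)
    (judge_sample : simple_random_sample P K SJ)
    (samples_independent : mutually_independent P
      (tnth [tuple
        <<s sigma_family alpha `|` sigma_family beta `|` sigma_family eps >>;
        sigma_sample SD; sigma_sample SJ])) :
  ('V_P[benchmark_score mu alpha beta gamma eps K SJ] =
    (sigma_alpha ^+ 2 / n%:R
     + sigma_beta ^+ 2 / (n * m)%N%:R
     + sigma_eps ^+ 2 / (n * m * K)%N%:R
     + judge_variance gamma / K%:R * ((Ktot - K)%N%:R / (Ktot - 1)%N%:R))%:E)%E.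
Proof.
have /andP[K0 KKtot] := hK.
have nz (k : nat) : (0 < k)%N -> k%:R != 0 :> R by rewrite pnatr_eq0 -lt0n.
have n0 := nz _ hn; have m0 := nz _ hm; have K0R := nz _ K0.
(* One index type for all three families, so that [variance_lincomb] is used once. *)
pose J := ('I_n + 'I_n * 'I_m + 'I_n * 'I_m * 'I_Ktot)%type.
pose Z (j : J) : {RV P >-> R} := match j with
  | inl (inl i) => alpha i | inl (inr p) => beta p | inr q => eps q end.
pose v (j : J) : R := match j with
  | inl (inl i) => sigma_alpha ^+ 2 | inl (inr p) => sigma_beta ^+ 2
  | inr q => sigma_eps ^+ 2 end.
pose k : R := (n * m * K)%N%:R^-1.
(* Given the judges [A], the score is the constant [r A] plus the effects weighted by [c A]. *)
pose r (A : {set 'I_Ktot}) : R :=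
  k * ((n * m)%N%:R * (#|A|%:R * mu + \sum_(l in A) gamma l)).
pose c (A : {set 'I_Ktot}) (j : J) : R := match j with
  | inl (inl i) => k * (m%:R * #|A|%:R) | inl (inr p) => k * #|A|%:R
  | inr q => k * (q.2 \in A)%:R end.
pose Y A : T -> R := cst (r A) \+ (fun w => \sum_j c A j * Z j w).
have scoreE :
    benchmark_score mu alpha beta gamma eps K SJ = fun w => Y (SJ w) w.
  apply/funext => w; rewrite benchmark_scoreE -/k /Y /r mulrDr; congr (_ + _).
  rewrite !big_sumType /= !mulrDr !mulr_sumr -addrA.
  by congr (_ + (_ + _)); apply: eq_bigr => i _; rewrite /= !mulrA.
have Z2 j : (Z j : T -> R) \in Lfun P 2%:E.
  case: j => [[i|p]|q]; [by have [] := alpha_moments i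
    |by have [] := beta_moments p|by have [] := eps_moments q].
have Z0 j : ('E_P[Z j] = 0)%E.
  case: j => [[i|p]|q]; [by have [] := alpha_moments i
    |by have [] := beta_moments p|by have [] := eps_moments q].
have Zv j : ('V_P[Z j] = (v j)%:E)%E.
  case: j => [[i|p]|q]; [by have [] := alpha_moments i
    |by have [] := beta_moments p|by have [] := eps_moments q].
have ab i p : independent_rv P (alpha i) (beta p).
  move=> A B mA mB.
  by apply: (mutually_independent2 (i := @Ordinal 3 0 isT)
    (j := @Ordinal 3 1 isT) effects_independent) => //;
    exact: sigma_family_preimage.
have ae i q : independent_rv P (alpha i) (eps q).
  move=> A B mA mB.
  by apply: (mutually_independent2 (i := @Ordinal 3 0 isT)
    (j := @Ordinal 3 2 isT) effects_independent) => //;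
    exact: sigma_family_preimage.
have be p q : independent_rv P (beta p) (eps q).
  move=> A B mA mB.
  by apply: (mutually_independent2 (i := @Ordinal 3 1 isT)
    (j := @Ordinal 3 2 isT) effects_independent) => //;
    exact: sigma_family_preimage.
(* Within a family this is the i.i.d. hypothesis; across families it is one of [ab], [ae], [be], up
   to symmetry. *)
have Zind i j : i != j -> independent_rv P (Z i) (Z j).
  case: i j => [[i|p]|q] [[i'|p']|q'] ij //=; try exact/independent_rvC.
  - by apply: iid_independent_rv => //; apply: contra_neq ij => ->.
  - by apply: iid_independent_rv => //; apply: contra_neq ij => ->.
  - by apply: iid_independent_rv => //; apply: contra_neq ij => ->.
have Y2 A : Y A \in Lfun P 2%:E.
  by rewrite /Y rpredD ?lee1n//= => _; [exact: Lfun_cst|exact: Lfun2_lincomb].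
have Yind A (D : set {set 'I_Ktot}) B : measurable B ->
    P (SJ @^-1` D `&` Y A @^-1` B) = (P (SJ @^-1` D) * P (Y A @^-1` B))%E.
  (* Components 0 and 2 of [samples_independent] are the sigma-algebra of all effects and that of
     the judge sample. *)
  move=> mB; rewrite setIC muleC.
  apply: (mutually_independent2 (i := @Ordinal 3 0 isT)
    (j := @Ordinal 3 2 isT) samples_independent) => //=; last first.
    by exists D => //; rewrite setTI.
  apply: sigma_algebra_affine => // -[[i|p]|q] C mC; apply: sub_sigma_algebra;
    [left; left|left; right|right]; exact: sigma_family_preimage.
pose s : R := sigma_alpha ^+ 2 / n%:R + sigma_beta ^+ 2 / (n * m)%N%:R +
  sigma_eps ^+ 2 / (n * m * K)%N%:R.
have EV (A : {set 'I_Ktot}) : #|A| = K ->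
    ('E_P[Y A] = (mu + K%:R^-1 * \sum_(l in A) gamma l)%:E /\
     'V_P[Y A] = s%:E)%E.
  move=> AK; split.
    rewrite expectationD ?Lfun_cst//; last exact/Lfun2_Lfun1/Lfun2_lincomb.
    rewrite expectation_cst expectation_lincomb; last first.
      by move=> j; exact/Lfun2_Lfun1.
    rewrite big1 ?adde0; last by move=> j _; rewrite Z0 mule0.
    rewrite /r /k AK !natrM; congr _%:E; field.
    by rewrite n0 m0 K0R.
  rewrite varianceD_cst_l; last exact: Lfun2_lincomb.
  rewrite (@variance_lincomb _ _ _ _ _ _ v)//; congr _%:E.
  rewrite !big_sumType /= !sumr_const card_prod !card_ord AK.
  rewrite -(pair_big xpredT xpredT
    (fun p l => (k * (l \in A)%:R) ^+ 2 * sigma_eps ^+ 2)) /=.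
  rewrite sumr_const card_prod !card_ord -big_distrl /=.
  (* A membership indicator equals its square, so each cell contributes [K] residual terms. *)
  under eq_bigr do rewrite exprMn -natrX -[(_ ^ 2)%N]mulnn mulnb andbb.
  have -> : \sum_(l < Ktot) k ^+ 2 * (l \in A)%:R = k ^+ 2 * K%:R.
    rewrite -mulr_sumr -AK -sum1_card natr_sum; congr (_ * _).
    rewrite [RHS]big_mkcond /=.
    by apply: eq_bigr => l _; case: (l \in A).

  exact: weighted_variances.
rewrite scoreE (variance_sample _ judge_sample Y2 Yind EV) ?card_ord//.
congr _%:E; rewrite -addrA; congr (_ + _).
have C0 : 'C(Ktot, K)%:R != 0 :> R by apply: nz; rewrite bin_gt0.
(* The conditional means average to [mu] since [gamma] averages out. In their second moment the
   cross term vanishes likewise, and [mu ^+ 2] cancels. *)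
rewrite [X in _ - (_ * X) ^+ 2]big_split /= sum_draws_const card_ord.
rewrite -mulr_sumr sum_draws//.
under eq_bigr do rewrite sqrrD.
rewrite 2!big_split /= sum_draws_const card_ord.
under [X in _ + X + _]eq_bigr do rewrite mulrA -mulrnAl.
rewrite -[X in _ + X + _]mulr_sumr sum_draws// !mulr0 !addr0 mulKf//.
under eq_bigr do rewrite exprMn.
(* [sum_draws_sqr] counts subsets of size [k.+1], hence [K.-1]. *)
have := sum_draws_sqr gamma_sum0 K.-1; rewrite card_ord prednK// => sqrE.
rewrite -mulr_sumr sqrE// mulrDr mulKf// addrAC subrr add0r.
rewrite [X in _ * X]mulrA mulrA bin_ratio//.
by rewrite /judge_variance mulrC !mulrA [LHS](ACl (2*1*3*4*5)).
Qed.
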